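(* Let $N$ be a positive integer that is not a perfect square, with continued fraction expansion $\sqrt N=[a_0;\overline{a_1,a_2,\ldots,a_{\tau-1},2a_0}]$ of (minimal) period length $\tau$. For $m\ge1$ let $\Lambda_m=(\Delta_m,\,2\Omega_m,\,\Delta_{m-1})\in\mathbb Z^3$, the coefficient triple of the quadratic form $\mathbf f_m(x,y)=\Delta_mx^2+2\Omega_mxy+\Delta_{m-1}y^2$. Then the map $m\mapsto\Lambda_m$ is injective on $\{1,2,\ldots,\tau\}$; that is, the quadratic forms $\mathbf f_1,\ldots,\mathbf f_\tau$ are pairwise distinct.
   Context: $a_0=\lfloor\sqrt N\rfloor$ and $(a_m)_{m\ge 0}$ are the partial quotients of $\sqrt N$. The convergents are defined by $A_{-1}=1$, $B_{-1}=0$, $A_0=a_0$, $B_0=1$, and for $m\ge1$: $A_m=a_mA_{m-1}+A_{m-2}$, $B_m=a_mB_{m-1}+B_{m-2}$. For $m\ge -1$, $\Delta_m=A_m^2-NB_m^2$, and for $m\ge0$, $\Omega_m=A_mA_{m-1}-NB_mB_{m-1}$. *)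

(* Defs.v *)
From mathcomp Require Import all_boot all_order all_algebra.
From mathcomp Require Import reals.

Set Implicit Arguments.
Unset Strict Implicit.
Unset Printing Implicit Defensive.

Import Order.TTheory GRing.Theory Num.Theory.
Local Open Scope ring_scope.

(* At a rational x the expansion stops; here it would continue with the
   junk value 0^-1 = 0. This is never reached for x irrational. *)
Fixpoint complete_quotient (R : realType) (x : R) (m : nat) : R :=
  if m is k.+1 then
    (complete_quotient x k - (Num.floor (complete_quotient x k))%:~R)^-1
  else x.

Definition partial_quotient (R : realType) (x : R) (m : nat) : int :=
  Num.floor (complete_quotient x m).

(* a_(m + t) = a_m for all m >= 1: the block a_1, ..., a_t repeats forever. *)
Definition repeats (a : nat -> int) (t : nat) : Prop :=
  (0 < t)%N /\ forall m, (1 <= m)%N -> a (m + t)%N = a m.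

Definition minimal_period (a : nat -> int) (t : nat) : Prop :=
  repeats a t /\ forall s, repeats a s -> (t <= s)%N.

(* a is the sequence [a_0; a_1, ..., a_(tau-1), 2 a_0, a_1, ...] whose
   repeating block a_1, ..., a_(tau-1), 2 a_0 has minimal length tau. *)
Definition sqrt_expansion (a : nat -> int) (tau : nat) : Prop :=
  minimal_period a tau /\ a tau = 2 * a 0%N.

Section Convergents.

Variables (R : realType) (N : nat).

Definition sqrt_pq : nat -> int := partial_quotient (Num.sqrt (N%:R : R)).

(* Indices are shifted by one so that they start at -1:
   convA k = A_(k-1), convB k = B_(k-1), Delta1 k = Delta_(k-1). *)
Fixpoint convA (k : nat) : int :=
  match k with
  | 0%N => 1
  | 1%N => sqrt_pq 0
  | (k'.+1 as k1).+1 => sqrt_pq k1 * convA k1 + convA k'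
  end.

Fixpoint convB (k : nat) : int :=
  match k with
  | 0%N => 0
  | 1%N => 1
  | (k'.+1 as k1).+1 => sqrt_pq k1 * convB k1 + convB k'
  end.

Definition Delta1 (k : nat) : int := convA k ^+ 2 - N%:Z * convB k ^+ 2.

(* Not shifted: Omega m = A_m A_(m-1) - N B_m B_(m-1), and likewise for
   Lambda m = (Delta_m, 2 Omega_m, Delta_(m-1)) and qform m = f_m below. *)
Definition Omega (m : nat) : int :=
  convA m.+1 * convA m - N%:Z * (convB m.+1 * convB m).

Definition Lambda (m : nat) : int * int * int :=
  (Delta1 m.+1, 2 * Omega m, Delta1 m).

Definition qform (m : nat) (x y : int) : int :=
  Delta1 m.+1 * x ^+ 2 + 2 * Omega m * x * y + Delta1 m * y ^+ 2.

End Convergents.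

(* Main.v *)
Require Import Defs.
From mathcomp Require Import all_boot all_order all_algebra.
From mathcomp Require Import reals.
From mathcomp Require Import zify ring lra.

Set Implicit Arguments.
Unset Strict Implicit.
Unset Printing Implicit Defensive.

Import Order.TTheory GRing.Theory Num.Theory.
Local Open Scope ring_scope.

(** Write [s] for the square root of [N], [p_m = A_m - s B_m],
    [q_m = A_m + s B_m], and [alpha_m] for the complete quotients. Then
    [alpha_(m+1) p_m = - p_(m-1)]; as the [alpha_m] are positive, the signs of
    the [p_m] alternate, hence so do those of [Delta_m = p_m q_m]. Multiplying
    by [q_m] gives [alpha_(m+1) Delta_m = - Omega_m - (-1)^m s]. So [Delta_m]
    determines the parity of [m], and [Lambda_m] determines [alpha_(m+1)] and
    with it all later partial quotients. If [Lambda_i = Lambda_j] with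
    [1 <= i < j <= tau], then [j - i < tau] would be a period. *)

(** For nonzero [y], [y ^+ 2] divides [x ^+ 2], so [y] divides [x], and [N] is the square of the
    quotient. *)
Lemma nonsquare_eq0 (N : nat) (x y : int) :
  ~ (exists k : nat, N = (k ^ 2)%N) -> x ^+ 2 = N%:Z * y ^+ 2 -> y = 0.
Proof.
move=> nsq /(congr1 absz); rewrite abszX abszM abszX /= => exy.
apply/eqP; rewrite -absz_eq0; apply/negPn/negP => y0.
have : (`|y| ^ 2 %| `|x| ^ 2)%N by rewrite exy dvdn_mull.
rewrite dvdn_pexp2r // => /dvdnP[k xk]; apply: nsq; exists k.
move: exy; rewrite xk expnMn => /eqP.
by rewrite eqn_pmul2r ?expn_gt0 ?lt0n ?y0 // => /eqP.
Qed.

Lemma complete_quotient_shift (R : realType) (x : R) (i j n : nat) :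
  complete_quotient x i = complete_quotient x j ->
  complete_quotient x (n + i) = complete_quotient x (n + j).
Proof. by move=> eij; elim: n => //= n ->. Qed.

Lemma repeats_mul (a : nat -> int) (t k m : nat) :
  repeats a t -> (1 <= m)%N -> a (m + k * t)%N = a m.
Proof.
move=> [_ per] m1; elim: k => [|k IHk]; first by rewrite mul0n addn0.
by rewrite mulSn addnCA addnC per // (leq_trans m1) ?leq_addr.
Qed.

(* A period that is only valid from some index on is valid from 1 on, by
   moving the index far to the right along the known period t. *)
Lemma repeats_eventually (a : nat -> int) (t d i : nat) :
  repeats a t -> (0 < d)%N ->
  (forall m, (i <= m)%N -> a (m + d)%N = a m) -> repeats a d.
Proof.
move=> pert d0 perd; split=> // m m1.
rewrite -(@repeats_mul a t i (m + d)) // ?(leq_trans m1) ?leq_addr //.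
rewrite addnAC perd ?repeats_mul //.
by rewrite (leq_trans _ (leq_addl _ _)) // leq_pmulr //; case: pert.
Qed.

Section SqrtConvergents.

Variables (R : realType) (N : nat).
Hypothesis nonsquareN : ~ exists k : nat, N = (k ^ 2)%N.

Let s : R := Num.sqrt N%:R.
Let alpha := complete_quotient s.
Let a := sqrt_pq R N.
Let A := convA R N.
Let B := convB R N.

(* Indices are shifted by one, as for [convA]: [p k] is p_(k-1). *)
Let p (k : nat) : R := (A k)%:~R - s * (B k)%:~R.
Let q (k : nat) : R := (A k)%:~R + s * (B k)%:~R.

Lemma sqr_sqrtN : s ^+ 2 = N%:R.
Proof. by rewrite sqr_sqrtr ?ler0n. Qed.

Lemma conv_det k : A k * B k.+1 - A k.+1 * B k = (-1) ^+ k.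
Proof.
elim: k => [|k IHk]; first by rewrite /A /B /= expr0; ring.
rewrite exprS -IHk.
have -> : A k.+2 = a k.+1 * A k.+1 + A k by [].
have -> : B k.+2 = a k.+1 * B k.+1 + B k by [].
ring.
Qed.

Lemma p_rec k : p k.+2 = (a k.+1)%:~R * p k.+1 + p k.
Proof.
rewrite /p.
have -> : A k.+2 = a k.+1 * A k.+1 + A k by [].
have -> : B k.+2 = a k.+1 * B k.+1 + B k by [].
by rewrite !rmorphD !rmorphM /=; ring.
Qed.

Lemma q_rec k : q k.+2 = (a k.+1)%:~R * q k.+1 + q k.
Proof.
rewrite /q.
have -> : A k.+2 = a k.+1 * A k.+1 + A k by [].
have -> : B k.+2 = a k.+1 * B k.+1 + B k by [].
by rewrite !rmorphD !rmorphM /=; ring.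
Qed.

(** A zero would force [B k = 0] by irrationality of [s], then [A k = 0], against the determinant
    being a sign. *)
Lemma p_neq0 k : p k != 0.
Proof.
apply/eqP => /eqP; rewrite subr_eq0 => /eqP pk0.
have AB : A k ^+ 2 = N%:Z * B k ^+ 2.
  apply: (@intr_inj R); rewrite [RHS]rmorphM !rmorphXn /= pk0 exprMn sqr_sqrtN.
  by rewrite -pmulrn.
have B0 := nonsquare_eq0 nonsquareN AB.
move: AB; rewrite B0 expr0n mulr0 => /eqP; rewrite sqrf_eq0 => /eqP A0.
by have := signr_eq0 int k; rewrite -conv_det A0 B0 mul0r mulr0 subr0 eqxx.
Qed.

Lemma alpha_floor_le k : (a k)%:~R <= alpha k.
Proof. exact: floor_le. Qed.

(** In the induction step [p k.+2] is minus the fractional part of [alpha k.+1] times [p k.+1]. As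
    [p k.+2] is nonzero, so is that fractional part, and the inverse defining [alpha k.+2] is a
    genuine one. *)
Lemma alpha_p k : alpha k.+1 * p k.+1 = - p k.
Proof.
elim: k => [|k IHk].
  have p1E : p 1 = - (s - (a 0)%:~R) by rewrite /p /A /B /= -/a; ring.
  have := p_neq0 1; rewrite p1E oppr_eq0 => d0.
  have -> : alpha 1 = (s - (a 0)%:~R)^-1 by [].
  by rewrite mulrN mulVf // /p /A /B /= mulr0 subr0.
have pE : p k.+2 = - (alpha k.+1 - (a k.+1)%:~R) * p k.+1.
  by rewrite p_rec -[p k]opprK -IHk; ring.
have := p_neq0 k.+2; rewrite pE mulf_eq0 negb_or oppr_eq0 => /andP[d0 _].
have -> : alpha k.+2 = (alpha k.+1 - (a k.+1)%:~R)^-1 by [].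
by rewrite mulNr mulrN mulrA mulVf // mul1r.
Qed.

Lemma alpha_ge0 k : 0 <= alpha k.
Proof.
case: k => [|k]; first exact: sqrtr_ge0.
have -> : alpha k.+1 = (alpha k - (a k)%:~R)^-1 by [].
by rewrite invr_ge0 subr_ge0 alpha_floor_le.
Qed.

Lemma a_ge0 k : 0 <= a k.
Proof. by rewrite /a /sqrt_pq /partial_quotient floor_ge0 alpha_ge0. Qed.

Lemma p_sign k : 0 < (-1) ^+ k * p k.
Proof.
elim: k => [|k IHk]; first by rewrite /p /A /B /= mulr0 subr0 mul1r.
have e : (-1) ^+ k * p k = alpha k.+1 * ((-1) ^+ k.+1 * p k.+1).
  by rewrite mulrCA alpha_p exprS; ring.
(* Only [0 <= alpha k.+1] is known so far; the value 0 would make the positive left side of [e]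
   vanish. *)
have := alpha_ge0 k.+1; rewrite le_eqVlt => /predU1P[a0|a0].
  by move: IHk; rewrite e -a0 mul0r ltxx.
by move: IHk; rewrite e pmulr_rgt0.
Qed.

Lemma q_gt0 k : 0 < q k.
Proof.
suff : 0 < q k /\ 0 < q k.+1 by case.
elim: k => [|k [qk qk1]].
  split; first by rewrite /q /A /B /= mulr0 addr0.
  have s0 : 0 < s.
    rewrite sqrtr_gt0 ltr0n lt0n; apply/eqP => N0.
    by apply: nonsquareN; exists 0.
  by rewrite /q /A /B /= mulr1 ltr_wpDl // ler0z a_ge0.
split=> //; rewrite q_rec ltr_wpDl // mulr_ge0 ?ler0z ?a_ge0 //.
exact: ltW.
Qed.

Lemma Delta1_pq k : (Delta1 R N k)%:~R = p k * q k.
Proof.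
rewrite /Delta1 rmorphB rmorphXn rmorphM rmorphXn /= -/A -/B -pmulrn -sqr_sqrtN /p /q.
ring.
Qed.

Lemma Delta1_sign k : 0 < (-1) ^+ k * (Delta1 R N k)%:~R :> R.
Proof. by rewrite Delta1_pq mulrA mulr_gt0 ?p_sign ?q_gt0. Qed.

Lemma Delta1_odd i j : Delta1 R N i = Delta1 R N j -> odd i = odd j.
Proof.
move=> e; have := Delta1_sign i; have := Delta1_sign j; rewrite e.
rewrite -(signr_odd _ i) -(signr_odd _ j).
by case: (odd i); case: (odd j); rewrite ?expr0 ?expr1 //; lra.
Qed.

(** By [alpha_p] the left side is [- p m * q m.+1]; expanding it, the rational part is [- Omega] and
    the coefficient of [s] is minus the determinant of [conv_det]. *)
Lemma alpha_Delta m :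
  alpha m.+1 * (Delta1 R N m.+1)%:~R = - (Omega R N m)%:~R - (-1) ^+ m * s.
Proof.
have -> : (-1) ^+ m = (((-1) ^+ m)%:~R : R) by rewrite rmorph_sign.
rewrite Delta1_pq mulrA alpha_p -conv_det /Omega -/A -/B.
rewrite !rmorphB !rmorphM /= -pmulrn -sqr_sqrtN /p /q.
ring.
Qed.

Lemma Lambda_alpha i j :
  Lambda R N i = Lambda R N j -> alpha i.+1 = alpha j.+1.
Proof.
case=> eD eO _.
have {}eO : Omega R N i = Omega R N j by lia.
have /= /negb_inj odd_ij := Delta1_odd eD.
have D0 : (Delta1 R N i.+1)%:~R != 0 :> R.
  by rewrite Delta1_pq mulf_neq0 ?p_neq0 // gt_eqF ?q_gt0.
apply: (mulIf D0); rewrite {2}eD !alpha_Delta eO.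
by rewrite -(signr_odd _ i) odd_ij signr_odd.
Qed.

Lemma Lambda_inj_period tau i j : minimal_period a tau ->
  (1 <= i)%N -> (j <= tau)%N -> Lambda R N i = Lambda R N j -> (j <= i)%N.
Proof.
move=> [per tau_min] i1 jt eL; rewrite leqNgt; apply/negP => ij.
(* Since [1 <= i] and [j <= tau], the shift [j - i] is smaller than [tau]. *)
suff /tau_min : repeats a (j - i) by lia.
apply: (@repeats_eventually a tau _ i.+1 per); first by rewrite subn_gt0.
move=> m im; rewrite /a /sqrt_pq /partial_quotient -/s.
have := complete_quotient_shift (m - i.+1) (Lambda_alpha eL).
by rewrite subnK // => ->; congr (Num.floor (complete_quotient s _)); lia.
Qed.

(** The values at (1,0), (0,1) and (1,1) recover the outer coefficients and then the middle one. *)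
Lemma qform_Lambda i j : qform R N i = qform R N j -> Lambda R N i = Lambda R N j.
Proof.
move=> e.
have e10 : qform R N i 1 0 = qform R N j 1 0 by rewrite e.
have e01 : qform R N i 0 1 = qform R N j 0 1 by rewrite e.
have e11 : qform R N i 1 1 = qform R N j 1 1 by rewrite e.
rewrite /qform in e10 e01 e11; rewrite /Lambda.
by congr (_, _, _); lia.
Qed.

End SqrtConvergents.

Theorem theorem3 (R : realType) (N tau : nat) (N_gt0 : (0 < N)%N)
    (N_nonsquare : ~ exists k : nat, N = (k ^ 2)%N)
    (N_expansion : sqrt_expansion (sqrt_pq R N) tau) :
  (forall i j : nat, (1 <= i <= tau)%N -> (1 <= j <= tau)%N ->
     Lambda R N i = Lambda R N j -> i = j) /\
  (forall i j : nat, (1 <= i <= tau)%N -> (1 <= j <= tau)%N ->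
     i <> j -> qform R N i <> qform R N j).
Proof.
have [tau_min _] := N_expansion.
have Lambda_inj i j : (1 <= i <= tau)%N -> (1 <= j <= tau)%N ->
    Lambda R N i = Lambda R N j -> i = j.
  move=> /andP[i1 it] /andP[j1 jt] eL; apply/anti_leq/andP; split.
    exact: (Lambda_inj_period N_nonsquare tau_min j1 it (esym eL)).
  exact: (Lambda_inj_period N_nonsquare tau_min i1 jt eL).
split=> // i j hi hj nij /qform_Lambda eL.
exact/nij/Lambda_inj.
Qed.
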